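(* For $p=2$ the inequality $$|x|^{p}+C_p|y|^{p}+p|x|^{p-2}x\cdot y\le|x+y|^{p},\qquad x,y\in\mathbb{R}^n,$$ holds with equality with $C_2=1$. Consequently the following remainder formula holds. Let $\mathbb{G}$ be a stratified group and let $0\le\rho\in C^1(\mathbb{G})$. Let $0\le F\in C^\infty(\mathbb{G})$ and $0\le\eta\in L^1_{loc}(\mathbb{G})$ be such that $$\eta F\le-\mathcal{L}_{2,\rho}F\quad\text{a.e. in }\mathbb{G}.$$ Then for all real-valued functions $f\in C_0^\infty(\mathbb{G})$, $$\left\|\rho^{1/2}F\,\nabla_H\frac fF\right\|_{L^2(\mathbb{G})}^2=\|\rho^{1/2}\nabla_Hf\|_{L^2(\mathbb{G})}^2-\|\eta^{1/2}f\|_{L^2(\mathbb{G})}^2.$$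
   Context: A stratified group (homogeneous Carnot group) is a Lie group $\mathbb{G}=(\mathbb{R}^n,\circ)$ such that: (a) for some natural numbers $N=N_1,N_2,\dots,N_r$ with $N_1+\dots+N_r=n$, writing $\mathbb{R}^n=\mathbb{R}^{N}\times\mathbb{R}^{N_2}\times\dots\times\mathbb{R}^{N_r}$, for every $\lambda>0$ the dilation $\delta_\lambda(x',x^{(2)},\dots,x^{(r)})=(\lambda x',\lambda^2x^{(2)},\dots,\lambda^r x^{(r)})$ is an automorphism of $\mathbb{G}$, where $x'\in\mathbb{R}^N$ and $x^{(k)}\in\mathbb{R}^{N_k}$; (b) if $X_1,\dots,X_N$ are the left-invariant vector fields on $\mathbb{G}$ with $X_k(0)=\partial/\partial x'_k|_0$, then the iterated commutators of $X_1,\dots,X_N$ span the Lie algebra of $\mathbb{G}$ (rank $n$ at every point). $\nabla_H=(X_1,\dots,X_N)$ is the horizontal gradient, $|\nabla_H f|=(\sum_k|X_kf|^2)^{1/2}$, and $\mathrm{div}_Hv=\sum_{k=1}^NX_kv_k$. $\mathcal{L}_{2,\rho}F=\mathrm{div}_H(\rho(x)\nabla_HF)$. $L^2(\mathbb{G})$ is with respect to Lebesgue measure $dx$ on $\mathbb{R}^n$ (the Haar measure of $\mathbb{G}$); the norm of a vector-valued function is that of its Euclidean length. $C_0^\infty(\mathbb{G})$ denotes smooth compactly supported functions.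
   Formalization: The printed equality fails under ''≤'' (G=R, ρ=(1+x²)², F=1/(1+x²), η=0): proved are LHS ≤ RHS under ηF ≤ −L_{2,ρ}F a.e., and equality when ηF = −L_{2,ρ}F a.e.; F>0 is assumed on supp f, since f/F is undefined where F=0. *)

(* Defs.v *)
From HB Require Import structures.
From mathcomp Require Import all_boot all_order all_algebra.
From mathcomp Require Import all_classical all_reals all_analysis.

Set Implicit Arguments.
Unset Strict Implicit.
Unset Printing Implicit Defensive.

Import Order.TTheory GRing.Theory Num.Theory.
Import numFieldNormedType.Exports.

Local Open Scope classical_set_scope.
Local Open Scope ring_scope.

(* The norm that the library puts on 'rV[R]_n is the max norm, hence the
   separate Euclidean length; the topology is the same. *)
Definition dotp (R : realType) (n : nat) (x y : 'rV[R]_n) : R :=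
  \sum_(i < n) x 0 i * y 0 i.

Definition enorm (R : realType) (n : nat) (x : 'rV[R]_n) : R :=
  Num.sqrt (dotp x x).

(* |x|^p + C |y|^p + p |x|^(p-2) x.y, where 0 `^ 0 = 1. *)
Definition expansion (R : realType) (n : nat) (p C : R) (x y : 'rV[R]_n) : R :=
  enorm x `^ p + C * enorm y `^ p + p * enorm x `^ (p - 2) * dotp x y.

(* The Borel sigma-algebra of R^n, generated by the coordinates. *)
Section rV_measurable.
Context {R : realType} {n : nat}.

Definition coord_rV (i : 'I_n) (x : 'rV[R]_n) : measurableTypeR R := x 0 i.

Definition measurable_rV : set (set 'rV[R]_n) := g_sigma_preimage coord_rV.

Let measurable_rV0 : measurable_rV set0.
Proof. exact: sigma_algebra0. Qed.

Let measurable_rVC A : measurable_rV A -> measurable_rV (~` A).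
Proof. exact: sigma_algebraC. Qed.

Let measurable_rV_bigcup (F : (set 'rV[R]_n)^nat) :
  (forall i, measurable_rV (F i)) -> measurable_rV (\bigcup_i F i).
Proof. exact: sigma_algebra_bigcup. Qed.

HB.instance Definition _ := @isMeasurable.Build default_measure_display
  'rV[R]_n measurable_rV measurable_rV0 measurable_rVC measurable_rV_bigcup.

End rV_measurable.

Definition cons_rV (R : realType) (n : nat) (p : measurableTypeR R * 'rV[R]_n) :
  'rV[R]_n.+1 := row_mx (p.1%:M : 'rV[R]_1) p.2.

Lemma measurable_coord_rV (R : realType) (n : nat) (i : 'I_n) :
  measurable_fun [set: 'rV[R]_n] (coord_rV i).
Proof.
move=> _ A mA; rewrite setTI; apply: sub_sigma_algebra; rewrite -bigcup_seq.
by exists i => /=; [rewrite mem_index_enum|exists A => //; rewrite setTI].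
Qed.

Lemma measurable_fun_rV (R : realType) (n : nat) d (T : measurableType d)
    (f : T -> 'rV[R]_n) :
  (forall i, measurable_fun setT (coord_rV i \o f)) -> measurable_fun setT f.
Proof.
move=> mf; apply: (@measurability _ _ _ _ _ _
  (\big[setU/set0]_(i < n) preimage_set_system setT (@coord_rV R n i)
     measurable)) => //.
move=> _ [B + <-]; rewrite -bigcup_seq => -[i _ [A mA <-]].
by rewrite !setTI -comp_preimage -[X in measurable X]setTI; exact: mf.
Qed.

Lemma measurable_cons_rV (R : realType) (n : nat) :
  measurable_fun [set: measurableTypeR R * 'rV[R]_n] (@cons_rV R n).
Proof.
apply: measurable_fun_rV => i.
have [j ->|j ->] := fintype.split_ordP (i : 'I_(1 + n)).
  rewrite (_ : _ \o _ = fst); first exact: measurable_fst.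
  apply/funext => p; rewrite /comp/= /coord_rV.
  by apply: etrans (row_mxEl _ _ _ _) _; rewrite mxE !ord1.
rewrite (_ : _ \o _ = coord_rV j \o snd).
  by apply: measurableT_comp; first exact: measurable_coord_rV.
by apply/funext => p; rewrite /comp/= /coord_rV; exact: row_mxEr.
Qed.

Section lebesgue_cons.
Context {R : realType} {n : nat}.
Variable mu : {sigma_finite_measure set 'rV[R]_n -> \bar R}.

Definition lebesgue_cons : set 'rV[R]_n.+1 -> \bar R :=
  pushforward (@lebesgue_measure R \x mu)%E (@cons_rV R n).

HB.instance Definition _ := Measure.copy lebesgue_cons
  (measure_function_pushforward__canonical__measure_function_Measure
     (@lebesgue_measure R \x mu)%E (@measurable_cons_rV R n)).

Let uncons_rV (x : 'rV[R]_n.+1) : measurableTypeR R * 'rV[R]_n :=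
  (x 0 0, rsubmx (x : 'rV_(1 + n))).

Let cons_rVK : cancel (@cons_rV R n) uncons_rV.
Proof.
move=> [a v]; rewrite /uncons_rV /cons_rV /=; congr pair; last exact: row_mxKr.
rewrite (_ : 0 = lshift n (0 : 'I_1)); last exact/val_inj.
by apply: etrans (row_mxEl _ _ _ _) _; rewrite mxE.
Qed.

Let measurable_uncons_rV : measurable_fun setT uncons_rV.
Proof.
apply/measurable_fun_pairP; split.
  exact: measurable_coord_rV.
apply: measurable_fun_rV => i.
rewrite (_ : _ \o _ = coord_rV (rshift 1 i)); first exact: measurable_coord_rV.
by apply/funext => x; rewrite /= /coord_rV mxE.
Qed.

Let lebesgue_cons_sigma_finite : sigma_finite setT lebesgue_cons.
Proof.
have /sigma_finiteP[F [TF ndF Foo]] := sigma_finiteT (@lebesgue_measure R).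
have /sigma_finiteP[G [TG ndG Goo]] := sigma_finiteT mu.
exists (fun k => uncons_rV @^-1` (F k `*` G k)).
  rewrite -preimage_bigcup (_ : \bigcup_k _ = setT) ?preimage_setT//.
  rewrite -subTset => -[x y] _.
  have [i _ Fx] : (\bigcup_k F k) x by rewrite -TF.
  have [j _ Gy] : (\bigcup_k G k) y by rewrite -TG.
  exists (maxn i j) => //; split.
  - by move: x Fx; exact/subsetPset/ndF/leq_maxl.
  - by move: y Gy; exact/subsetPset/ndG/leq_maxr.
move=> k; have [mF Fk] := Foo k; have [mG Gk] := Goo k; split.
  by rewrite -[X in measurable X]setTI; apply: measurable_uncons_rV => //;
     exact: measurableX.
rewrite /lebesgue_cons /pushforward -comp_preimage.
rewrite (_ : _ \o _ = idfun); last by apply/funext => x; exact: cons_rVK.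
by rewrite preimage_id product_measure1E// lte_mul_pinfty// ge0_fin_numE.
Qed.

HB.instance Definition _ := Measure_isSigmaFinite.Build _ _ _ lebesgue_cons
  lebesgue_cons_sigma_finite.

End lebesgue_cons.

Fixpoint lebesgue_rV (R : realType) (n : nat) :
    {sigma_finite_measure set 'rV[R]_n -> \bar R} :=
  match n with
  | 0 => dirac (0 : 'rV[R]_0)
  | m.+1 => lebesgue_cons (lebesgue_rV R m)
  end.

Fixpoint Ck (R : realType) (V W : normedModType R) (k : nat) (f : V -> W) :
    Prop :=
  match k with
  | 0 => continuous f
  | m.+1 => [/\ continuous f, forall v x, derivable f x v
              & forall v, Ck m (fun x => 'D_v f x)]
  end.

Definition smooth (R : realType) (V W : normedModType R) (f : V -> W) : Prop :=
  forall k, Ck k f.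

Definition lie_bracket (R : realType) (V : normedModType R) (Y Z : V -> V) :
    V -> V :=
  fun x => 'D_(Y x) Z x - 'D_(Z x) Y x.

Inductive iterated_commutator (R : realType) (V : normedModType R)
    (S : set (V -> V)) : (V -> V) -> Prop :=
  | commutator_gen Y : S Y -> iterated_commutator S Y
  | commutator_bracket Y Z : iterated_commutator S Y ->
      iterated_commutator S Z -> iterated_commutator S (lie_bracket Y Z).

(* With N = [:: N_1; ...; N_r], the coordinates of R^n = R^(sumn N) are listed
   stratum by stratum; reshape_index N i counts the strata before that of i. *)
Definition dilation (R : realType) (N : seq nat) (l : R)
    (x : 'rV[R]_(sumn N)) : 'rV[R]_(sumn N) :=
  \row_i (l ^+ (reshape_index N i).+1 * x 0 i).

Definition horizontal (N : seq nat) (i : 'I_(sumn N)) : bool :=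
  (i < head 0 N)%N.

(* The value at x of the left-invariant vector field that equals d/dx_k at the
   origin, i.e. the image of d/dx_k|_0 under the differential at 0 of the left
   translation by x. *)
Definition left_invariant_field (R : realType) (n : nat)
    (op : 'rV[R]_n -> 'rV[R]_n -> 'rV[R]_n) (k : 'I_n) (x : 'rV[R]_n) :
    'rV[R]_n :=
  'D_(delta_mx 0 k) (op x) 0.

Record stratifiedGroup (R : realType) := StratifiedGroup {
  strata : seq nat;
  sg_op : 'rV[R]_(sumn strata) -> 'rV[R]_(sumn strata) -> 'rV[R]_(sumn strata);
  sg_one : 'rV[R]_(sumn strata);
  sg_inv : 'rV[R]_(sumn strata) -> 'rV[R]_(sumn strata);
  strata_neq0 : strata != [::];
  strata_gt0 : all (fun d => 0 < d)%N strata;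
  sg_opA : associative sg_op;
  sg_op1x : left_id sg_one sg_op;
  sg_opx1 : right_id sg_one sg_op;
  sg_opVx : left_inverse sg_one sg_inv sg_op;
  sg_opxV : right_inverse sg_one sg_inv sg_op;
  sg_op_smooth :
    smooth (fun p : 'rV[R]_(sumn strata) * 'rV[R]_(sumn strata) =>
      sg_op p.1 p.2);
  sg_inv_smooth : smooth sg_inv;
  (* dilation l is a linear bijection, so being an automorphism amounts to
     compatibility with the group law *)
  sg_dilation : forall l : R, 0 < l -> {morph dilation l : x y / sg_op x y};
  sg_hormander : forall x : 'rV[R]_(sumn strata),
    exists2 Y : 'I_(sumn strata) -> 'rV[R]_(sumn strata) -> 'rV[R]_(sumn strata),
      forall i, iterated_commutator
        [set left_invariant_field sg_op k | k in [set k | horizontal k]] (Y i)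
      & \rank (\matrix_i Y i x) = sumn strata }.

Section stratified_group.
Context {R : realType}.
Variable G : stratifiedGroup R.

Definition sg_dim : nat := sumn (strata G).

Local Notation V := 'rV[R]_sg_dim.

(* Not a field of the structure: the dilations fix the identity element. *)
Lemma sg_one0 : sg_one G = 0 :> V.
Proof.
pose a := dilation 2 (sg_one G).
have aa : sg_op a a = a.
  by rewrite -(@sg_dilation R G 2) ?ltr0n// (@sg_op1x R G).
have d1 : a = sg_one G.
  by rewrite -(@sg_opVx R G a) -[X in _ = sg_op _ X]aa (@sg_opA R G) (@sg_opVx R G)
    (@sg_op1x R G).
apply/rowP => i; have /rowP/(_ i)/eqP := d1; rewrite !mxE.
rewrite -[X in _ == X]mul1r -subr_eq0 -mulrBl mulf_eq0 => /orP[|/eqP//].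
by rewrite subr_eq0 gt_eqF// exprn_egt1// ltr1n.
Qed.

Definition leftX (k : 'I_sg_dim) : V -> V := left_invariant_field (@sg_op R G) k.

Lemma leftX0 (k : 'I_sg_dim) : leftX k 0 = delta_mx 0 k.
Proof.
rewrite /leftX /left_invariant_field (_ : sg_op _ = id) ?derive_id//.
by apply/funext => y; rewrite -sg_one0 sg_op1x.
Qed.

Definition Xder (k : 'I_sg_dim) (f : V -> R) : V -> R :=
  fun x => 'D_(leftX k x) f x.

(* The N_1 horizontal components are stored as a row of length sg_dim whose
   other entries are 0. *)
Definition gradH (f : V -> R) : V -> V :=
  fun x => \row_k (if horizontal k then Xder k f x else 0).

Definition divH (v : V -> V) : V -> R :=
  fun x => \sum_(k < sg_dim | horizontal k) Xder k (fun y => v y 0 k) x.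

Definition L2rho (rho F : V -> R) : V -> R :=
  divH (fun x => rho x *: gradH F x).

Definition haar : {measure set V -> \bar R} := lebesgue_rV R sg_dim.

Definition supp (f : V -> R) : set V := closure [set x | f x != 0].

Definition test_function (f : V -> R) : Prop :=
  smooth f /\ compact (supp f).

Definition L1loc (eta : V -> R) : Prop :=
  measurable_fun [set: V] eta /\
  forall K : set V, compact K -> (\int[haar]_(x in K) `|eta x|%:E < +oo)%E.

Definition L2norm (f : V -> R) : \bar R := ('N[haar]_2%:E [EFin \o f])%E.

Definition L2normv (v : V -> V) : \bar R := L2norm (fun x => enorm (v x)).

End stratified_group.

(* Main.v *)
Require Import Defs.
From mathcomp Require Import all_boot all_order all_algebra.
From mathcomp Require Import all_classical all_reals all_analysis.
From mathcomp Require Import measurable_realfun ring.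

Import Order.TTheory GRing.Theory Num.Theory.
Import numFieldNormedType.Exports.

Local Open Scope classical_set_scope.
Local Open Scope ring_scope.

(** The first part is the polarization of a Euclidean square.

    For the second part put h = f / F. Since F > 0 on the support of f, h is of
    class C^1 and f = h F everywhere, so X_k f = F X_k h + h X_k F. Expanding
    the square gives, at every point,
      rho F^2 |grad_H h|^2
        = rho |grad_H f|^2 - rho grad_H F . grad_H (h^2 F),
    and the subtracted term is div_H (h^2 F rho grad_H F) - h^2 F L_{2,rho} F by the
    product rule (pointwise_identity). The flux h^2 F rho grad_H F is C^1 with
    compact support, so its horizontal divergence has integral 0
    (integral_Xder) and
      ||rho^(1/2) F grad_H h||^2
        = ||rho^(1/2) grad_H f||^2 - int h^2 F (- L_{2,rho} F)
    (integral_remainder). Multiplying eta F <= - L_{2,rho} F by h^2 F >= 0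
    bounds int eta f^2 by the last integral (potential_le), with equality when
    the differential inequality is an equality (potential_eq).

    The divergence theorem comes from the dilations. Writing
    X_k = sum_j a_kj d/dx_j, the compatibility of the group law with the
    dilations makes a_kj homogeneous of degree s_j - 1, where s_j is the weight
    of the j-th coordinate. Its derivative in x_j is then homogeneous of degree
    -1 and continuous at the origin, hence zero (derive_coefX_eq0). So X_k is
    divergence free for Lebesgue measure, X_k w = sum_j d(a_kj w)/dx_j, and each
    term integrates to 0 by Fubini and the fundamental theorem of calculus
    (integral_derive_rV). *)

(** * The Euclidean identity *)

Lemma dotpDD (R : realType) (n : nat) (x y : 'rV[R]_n) :
  dotp (x + y) (x + y) = dotp x x + dotp y y + 2 * dotp x y.
Proof.
rewrite /dotp mulr_sumr -!big_split /=; apply: eq_bigr => i _.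
by rewrite !mxE; ring.
Qed.

Lemma dotp_ge0 (R : realType) (n : nat) (x : 'rV[R]_n) : 0 <= dotp x x.
Proof. by apply: sumr_ge0 => i _; rewrite -expr2 sqr_ge0. Qed.

Lemma enorm_sqr (R : realType) (n : nat) (x : 'rV[R]_n) :
  enorm x ^+ 2 = dotp x x.
Proof. by rewrite sqr_sqrtr// dotp_ge0. Qed.

Lemma expansion2 (R : realType) (n : nat) (x y : 'rV[R]_n) :
  expansion 2 1 x y = enorm (x + y) `^ 2.
Proof.
rewrite /expansion subrr powRr0 !powR_mulrn ?sqrtr_ge0// !enorm_sqr mul1r mulr1.
by rewrite dotpDD.
Qed.

(** * Calculus of C^1 functions *)

Section derive_along_line.
Context {R : numFieldType} {U V W : normedModType R}.

(** A directional derivative only sees the restriction to a line; this replaces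
    the chain rule for affine changes of variables. *)
Lemma eq_on_line (f : U -> W) (g : V -> W) x u y v :
  (forall h : R, f (h *: u + x) = g (h *: v + y)) ->
  'D_u f x = 'D_v g y /\ (derivable f x u -> derivable g y v).
Proof.
move=> fg; have fgxy : f x = g y by have := fg 0; rewrite !scale0r !add0r.
have E : (fun h : R => h^-1 *: ((f \o shift x) (h *: u) - f x)) =
         (fun h : R => h^-1 *: ((g \o shift y) (h *: v) - g y)).
  by apply/funext => h /=; rewrite fg fgxy.
by rewrite /derive /derivable E.
Qed.

End derive_along_line.

Section calculus.
Context {R : realType} {V : normedModType R}.
Implicit Types (f g : V -> R) (x u v : V).

Lemma is_derive_line f y v (s : R) : derivable f (s *: v + y) v ->
  is_derive s (1 : R) (fun t : R => f (t *: v + y)) ('D_v f (s *: v + y)).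
Proof.
move=> df; have E : (fun h : R => h^-1 *: (((fun t : R => f (t *: v + y)) \o shift s)
    (h *: (1 : R)) - f (s *: v + y)))
  = (fun h => h^-1 *: ((f \o shift (s *: v + y)) (h *: v) - f (s *: v + y))).
  by apply/funext => h /=; rewrite scalerDl addrA [h *: 1]mulr1.
by split; rewrite /derivable /derive E.
Qed.

(** The intermediate point is controlled by its distance to the endpoint 0, so
    that both signs of h are covered at once. *)
Lemma directional_MVT f v y (h : R) : (forall x, derivable f x v) ->
  exists2 s : R, `|s| <= `|h| & f (h *: v + y) - f y = h * 'D_v f (s *: v + y).
Proof.
move=> df; pose phi := fun t : R => f (t *: v + y).
have dphi t : is_derive t (1 : R) phi ('D_v f (t *: v + y)) by exact: is_derive_line.
have cphi (a b : R) : {within `[a, b], continuous phi}.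
  by apply: derivable_within_continuous => t _; case: (dphi t).
have phi0 : phi 0 = f y by rewrite /phi scale0r add0r.
have [h0|h0] := leP 0 h.
  have [s] := MVT_segment h0 (fun t _ => dphi t) (cphi 0 h).
  rewrite in_itv /= => /andP[s0 sh]; rewrite phi0 subr0 mulrC => ->.
  by exists s => //; rewrite !ger0_norm.
have [s] := MVT_segment (ltW h0) (fun t _ => dphi t) (cphi h 0).
rewrite in_itv /= => /andP[sh s0]; rewrite phi0 => E.
exists s; last by rewrite -opprB E sub0r mulrN opprK mulrC.
by rewrite (ler0_norm s0) (ler0_norm (ltW h0)) lerN2.
Qed.

(** The increment along u + v is an increment along v followed by one along u.
    By the mean value theorem the quotient of the former is a value of 'D_v f at
    a nearby point, and this derivative is continuous. *)
Lemma deriveDr f x u v : Ck 1 f -> 'D_(u + v) f x = 'D_u f x + 'D_v f x.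
Proof.
move=> [_ df cf]; apply: cvg_lim => //.
have Hu : (fun h : R => h^-1 *: (f (h *: u + x) - f x)) @ 0^' --> 'D_u f x.
  exact: df.
have Hv : (fun h : R => h^-1 *: (f (h *: v + (h *: u + x)) - f (h *: u + x))) @ 0^'
    --> 'D_v f x.
  apply/cvgrPdist_le => e e0.
  have /cvgrPdist_le/(_ _ e0) := cf v x.
  move=> /nbhs_ballP[r /= r0 rP].
  have rho0 : 0 < r / (`|u| + `|v| + 1) by rewrite divr_gt0// ltr_wpDl// addr_ge0.
  near=> h; have hn0 : h != 0 by near: h; exact: nbhs_dnbhs_neq.
  have [s sh ->] := directional_MVT f v (h *: u + x) h (df v).
  rewrite [_ *: _]mulKf//; apply: rP.
  rewrite -ball_normE /= addrA opprD addrCA subrr addr0 normrN.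
  have hb : `|h| < r / (`|u| + `|v| + 1).
    by near: h; exact: dnbhs0_lt.
  rewrite (le_lt_trans (ler_normD _ _))// !normrZ.
  rewrite ltr_pdivlMr ?ltr_wpDl ?addr_ge0// in hb.
  apply: le_lt_trans hb; rewrite mulrDr mulr1 mulrDr addrC.
  apply: le_trans (_ : `|h| * `|u| + `|h| * `|v| <= _); last by rewrite lerDl.
  by rewrite lerD2l ler_wpM2r.
rewrite [X in _ --> X]addrC; apply: cvg_trans (cvgD Hv Hu).
apply: near_eq_cvg; apply: nearW => h /=.
rewrite [LHS]/= -[LHS]/(_ *: _ + _ *: _) -scalerDr; congr (_ *: _).
by rewrite subrKA scalerDr [h *: u + h *: v]addrC addrA.
Unshelve. all: by end_near. Qed.

Lemma deriveZr f x v (c : R) : derivable f x v -> 'D_(c *: v) f x = c * 'D_v f x.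
Proof.
move=> df; have [->|c0] := eqVneq c 0; first by rewrite scale0r derive0 mul0r.
have Hv : is_derive (0 : R) (1 : R) (fun t : R => f (t *: v + x)) ('D_v f x).
  have Ex : (0 : R) *: v + x = x by rewrite scale0r add0r.
  by move: df (is_derive_line f x v 0); rewrite Ex => df'; apply.
have Hc : is_derive (0 : R) (1 : R) (fun t : R => f ((c * t) *: v + x)) (c * 'D_v f x).
  pose g := fun t : R => c * t.
  have dg : is_derive (0 : R) (1 : R) g c.
    have := @is_deriveZ _ _ _ (id : R -> R) c 0 1 1 _.
    by move=> /(_ (is_derive_id _ _)); rewrite [c *: 1]mulr1; exact.
  have dv : is_derive (g 0) (1 : R) (fun t : R => f (t *: v + x)) ('D_v f x).
    by rewrite /g mulr0.
  split.
    apply/derivable1_diffP/(@differentiable_comp _ _ _ _ g (fun t : R => f (t *: v + x))).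
      by apply/derivable1_diffP; case: dg.
    by apply/derivable1_diffP; case: dv.
  rewrite -derive1E (@derive1_comp _ g (fun t : R => f (t *: v + x))).
  - by rewrite !derive1E (@derive_val _ _ _ _ _ _ _ dg) (@derive_val _ _ _ _ _ _ _ dv) mulrC.
  - by case: dg.
  - by case: dv.
rewrite -(@derive_val _ _ _ _ _ _ _ Hc) /derive.
set F1 := (X in fmap X); set F2 := (X in _ = lim (fmap X _)).
suff -> : F1 = F2 by [].
apply/funext => h; rewrite /F1 /F2 /=.
by rewrite scalerA addr0 mulr0 scale0r add0r [h *: 1]mulr1 mulrC.
Qed.

Lemma Ck1_cst (c : R) : Ck 1 (fun _ : V => c).
Proof.
split => [x|v x|v].
- exact: cst_continuous.
- exact: derivable_cst.
- suff -> : 'D_v (fun=> c) = cst (0 : R) by move=> x; exact: cst_continuous.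
  by apply/funext => x; exact: (derive_cst c x v).
Qed.

Lemma Ck1_add f g : Ck 1 f -> Ck 1 g -> Ck 1 (fun x => f x + g x).
Proof.
move=> [cf df Df] [cg dg Dg]; split => [x|v x|v].
- exact: (continuousD (cf x) (cg x)).
- exact: (derivableD (df v x) (dg v x)).
- rewrite (_ : 'D_v _ = fun x => 'D_v f x + 'D_v g x).
    by move=> x; exact: (continuousD (Df v x) (Dg v x)).
  by apply/funext => x; exact: deriveD.
Qed.

Lemma derive_mul f g x v : derivable f x v -> derivable g x v ->
  'D_v (fun y => f y * g y) x = 'D_v f x * g x + f x * 'D_v g x.
Proof. by move=> df dg; rewrite (deriveM df dg) addrC /GRing.scale/= mulrC. Qed.

Lemma Ck1_mul f g : Ck 1 f -> Ck 1 g -> Ck 1 (fun x => f x * g x).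
Proof.
move=> [cf df Df] [cg dg Dg]; split => [x|v x|v].
- exact: (continuousM (cf x) (cg x)).
- exact: (derivableM (df v x) (dg v x)).
- rewrite (_ : 'D_v _ = fun x => 'D_v f x * g x + f x * 'D_v g x).
    move=> x; exact: (continuousD (continuousM (Df v x) (cg x))
      (continuousM (cf x) (Dg v x))).
  by apply/funext => x; exact: derive_mul.
Qed.

Lemma Ck1_sum (I : Type) (s : seq I) (P : pred I) (F : I -> V -> R) :
  (forall i, P i -> Ck 1 (F i)) ->
  Ck 1 (fun x => \sum_(i <- s | P i) F i x) /\
  forall x v, 'D_v (fun x => \sum_(i <- s | P i) F i x) x =
              \sum_(i <- s | P i) 'D_v (F i) x.
Proof.
move=> HF; elim: s => [|i s [CS DS]].
  have -> : (fun x => \sum_(i <- [::] | P i) F i x) = cst 0.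
    by apply/funext => y; rewrite big_nil.
  by split => [|x v]; [exact: Ck1_cst|rewrite big_nil; exact: derive_cst].
have [Pi|nPi] := boolP (P i); last first.
  have -> : (fun x => \sum_(i <- i :: s | P i) F i x) =
      (fun x => \sum_(i <- s | P i) F i x).
    by apply/funext => y; rewrite big_cons (negbTE nPi).
  by split => // x v; rewrite DS big_cons (negbTE nPi).
have -> : (fun x => \sum_(i <- i :: s | P i) F i x) =
    (fun x => F i x + \sum_(i <- s | P i) F i x).
  by apply/funext => y; rewrite big_cons Pi.
have Ci := HF i Pi; split => [|x v]; first exact: Ck1_add.
rewrite big_cons Pi -DS; apply: deriveD; first by case: Ci.
by case: CS.
Qed.

(** At a point outside the closed support of g the quotient vanishes nearby,
    whatever h does there. *)
Lemma continuous_div_supp f g (h : V -> R) : continuous f -> continuous h ->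
  (forall x, closure [set y | g y != 0] x -> h x != 0) ->
  (forall x, ~ closure [set y | g y != 0] x -> f x = 0) ->
  continuous (fun x => f x / h x).
Proof.
move=> cf ch h0 f0 x.
have [sx|nsx] := pselect (closure [set y | g y != 0] x).
  exact: (continuousM (cf x) (continuousV (h0 x sx) (ch x))).
have nz : \forall y \near x, f y = 0.
  have : open_nbhs x (~` closure [set y | g y != 0]).
    by split => //; exact/closed_openC/closed_closure.
  by move=> /open_nbhs_nbhs; apply: filterS => y; exact: f0.
apply: cvg_near_cst; apply: filterS nz => y fy.
by rewrite (f0 x)// fy !mul0r.
Qed.

Lemma near_eq0_off_supp f x : ~ closure [set y | f y != 0] x ->
  \forall y \near x, f y = 0.
Proof.
move=> nsx; have : open_nbhs x (~` closure [set y | f y != 0]).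
  by split => //; exact/closed_openC/closed_closure.
move=> /open_nbhs_nbhs; apply: filterS => y nsy.
apply/eqP; apply: contra_notT nsy => fy; exact: subset_closure.
Qed.

Lemma derive_off_supp f x v : ~ closure [set y | f y != 0] x -> 'D_v f x = 0.
Proof.
move=> /near_eq0_off_supp f0.
by rewrite (near_eq_derive (g := cst 0))// derive_cst.
Qed.

(** The quotient f / h is 0 where h vanishes, because x / 0 = 0; as h may only
    vanish off the support of f, where f is locally 0, the quotient rule holds
    at every point. *)
Section quotient.
Variables f h : V -> R.
Hypotheses (C1f : Ck 1 f) (C1h : Ck 1 h).
Hypothesis h0 : forall x, closure [set y | f y != 0] x -> h x != 0.

Let near_div0 x : ~ closure [set y | f y != 0] x ->
  \forall y \near x, f y / h y = 0.
Proof. by move=> /near_eq0_off_supp; apply: filterS => y ->; rewrite mul0r. Qed.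

Lemma is_derive_div_supp x v : is_derive x v (fun y => f y / h y)
  (('D_v f x * h x - f x * 'D_v h x) / h x ^+ 2).
Proof.
have [cf df Df] := C1f; have [ch dh Dh] := C1h.
have [sx|nsx] := pselect (closure [set y | f y != 0] x); last first.
  have f0 : f x = 0 by exact: nbhs_singleton (near_eq0_off_supp _ _ nsx).
  rewrite derive_off_supp// f0 !mul0r subrr mul0r.
  apply: (near_eq_is_derive (f := cst 0)).
  by apply: filterS (near_div0 x nsx) => y ->.
have hx0 := h0 x sx.
have dV := derivableV hx0 (dh v x).
split; first exact: (derivableM (df v x) dV).
rewrite (derive_mul _ _ _ _ (df v x) dV) (deriveV hx0 (dh v x)) /GRing.scale /=.
rewrite mulrBl; congr (_ + _).
  by rewrite expr2 invfM mulrA mulfK.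
by rewrite mulNr mulrN [_^-1 * _]mulrC mulrA.
Qed.

Lemma derive_div_supp x v : 'D_v (fun y => f y / h y) x =
  ('D_v f x * h x - f x * 'D_v h x) / h x ^+ 2.
Proof. exact: (@derive_val _ _ _ _ _ _ _ (is_derive_div_supp x v)). Qed.

Lemma Ck1_div_supp : Ck 1 (fun y => f y / h y).
Proof.
have [cf df Df] := C1f; have [ch dh Dh] := C1h; split.
- apply: (continuous_div_supp f f h) => // x /near_eq0_off_supp.
  exact: nbhs_singleton.
- by move=> v x; case: (is_derive_div_supp x v).
- move=> v; rewrite (_ : 'D_v _ = fun x =>
    ('D_v f x * h x - f x * 'D_v h x) / h x ^+ 2); last first.
    by apply/funext => x; exact: derive_div_supp.
  apply: (continuous_div_supp _ f (fun x => h x ^+ 2)).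
  + move=> x; exact: (continuousB (continuousM (Df v x) (ch x))
      (continuousM (cf x) (Dh v x))).
  + move=> x; exact: (continuousM (ch x) (ch x)).
  + by move=> x sx; rewrite expf_neq0// h0.
  + move=> x nsx; rewrite derive_off_supp//.
    by rewrite (nbhs_singleton (near_eq0_off_supp _ _ nsx)) !mul0r subrr.
Qed.

End quotient.

Lemma Ck2_Ck1 f : Ck 2 f -> Ck 1 f.
Proof. by move=> [cf df Df]; split => // v; case: (Df v). Qed.

End calculus.

(** For a C^1 function 'D_v f x is linear in v, hence determined by the partial
    derivatives. *)
Lemma derive_rV {R : realType} {n : nat} (f : 'rV[R]_n -> R) (x v : 'rV[R]_n) :
  Ck 1 f -> 'D_v f x = \sum_(i < n) v 0 i * 'D_(delta_mx 0 i) f x.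
Proof.
move=> C1f; have [_ df _] := C1f.
rewrite {1}[v]row_sum_delta.
elim/big_ind2 : _ => [|a u b w <- <-|i _].
- by rewrite derive0.
- exact: deriveDr.
- exact: deriveZr.
Qed.

Lemma derive_vanishing_outside (R : realType) (V : normedModType R) (g : V -> R) M x v :
  (forall x, M < `|x| -> g x = 0) -> M < `|x| -> 'D_v g x = 0.
Proof.
move=> g0 Mx; rewrite (near_eq_derive (g := cst 0)) ?derive_cst//.
have : open_nbhs x [set y : V | M < `|y|].
  split => //; rewrite (_ : [set y | _] = (fun y => `|y|) @^-1` [set r | M < r])//.
  by apply: open_comp; [move=> y _; exact: norm_continuous|exact: open_gt].
by move=> /open_nbhs_nbhs; apply: filterS => s /g0.
Qed.

Lemma continuous_bigsum (R : realType) (T : topologicalType) (I : Type) (s : seq I)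
    (P : pred I) (F : I -> T -> R) : (forall i, P i -> continuous (F i)) ->
  continuous (fun x => \sum_(i <- s | P i) F i x).
Proof. by move=> cF; apply: continuous_big => //; exact: add_continuous. Qed.

(** * Lebesgue measure on row vectors *)

Section row_vectors.
Context {R : realType} {n : nat}.
Implicit Types x y : 'rV[R]_n.

Lemma norm_rV_le x (M : R) : 0 <= M ->
  (`|x| <= M) = [forall i, `|x 0 i| <= M].
Proof.
move=> M0; rewrite {1}/Num.Def.normr /= mx_normrE; apply/idP/forallP => [xM i|xM].
  by apply: le_trans xM; apply: (le_bigmax _ (fun ij => `|x ij.1 ij.2|) (0, i)).
by apply: bigmax_le => // -[a i] _ /=; rewrite ord1.
Qed.

Lemma continuous_coord i : continuous (fun x => x 0 i).
Proof. exact: coord_continuous. Qed.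

Lemma cvg_rV (T : Type) (F : set_system T) {FF : Filter F} (f : T -> 'rV[R]_n) x :
  (forall i, (fun t => f t 0 i) @ F --> x 0 i) -> f @ F --> x.
Proof.
move=> H; apply/cvgrPdist_le => e e0.
suff : \forall t \near F, forall i, `|x 0 i - f t 0 i| <= e.
  apply: filterS => t Ht; rewrite norm_rV_le ?ltW//; apply/forallP => i.
  by rewrite !mxE.
apply: filter_forall => i; have /cvgrPdist_le := H i; exact.
Qed.

(** An open set is the countable union of the boxes that it contains among those
    with rational centre and half side 1 / (k + 1). *)
Lemma open_measurable_rV (U : set 'rV[R]_n) : open U -> measurable U.
Proof.
move=> oU.
pose box (p : 'rV[rat]_n * nat) : set 'rV[R]_n :=
  \bigcap_(i in [set: 'I_n]) (coord_rV i @^-1` ball (ratr (p.1 0 i) : R) p.2.+1%:R^-1).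
have mbox p : measurable (box p).
  apply: fin_bigcap_measurable => [|i _]; first exact: finite_finset.
  rewrite -[X in measurable X]setTI; apply: measurable_coord_rV => //.
  exact: measurable_ball.
have -> : U = \bigcup_p (if `[< box p `<=` U >] then box p else set0).
  apply/seteqP; split => [x Ux|x [p _]]; last by case: asboolP => // pU; exact: pU.
  have /nbhs_ballP[e /= e0 eU] : nbhs x U by apply: open_nbhs_nbhs; split.
  have [k ke] : exists k : nat, k.+1%:R^-1 < e / 2.
    have /ltr_add_invr[k] : 0 < e / 2 by rewrite divr_gt0.
    by rewrite add0r; exists k.
  have k0 : 0 < k.+1%:R^-1 :> R by rewrite invr_gt0.
  have Hq i : {q : rat | `|ratr q - x 0 i| < k.+1%:R^-1}.
    apply: cid; have : x 0 i - k.+1%:R^-1 < x 0 i + k.+1%:R^-1.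
      by rewrite ltrD2l gtrN.
    by move=> /rat_in_itvoo[q]; rewrite in_itv /= -ltr_distl; exists q.
  pose q : 'rV[rat]_n := \row_i sval (Hq i).
  have xq : box (q, k) x.
    by move=> i _; rewrite /= mxE -ball_normE /=; case: (Hq i).
  exists (q, k) => //; rewrite (asboolT (P := box (q, k) `<=` U))//.
  move=> y yq; apply: eU; rewrite -ball_normE /=.
  apply: (@le_lt_trans _ _ (k.+1%:R^-1 + k.+1%:R^-1)); last first.
    by rewrite [e]splitr ltrD.
  rewrite norm_rV_le ?addr_ge0 ?ltW//; apply/forallP => i; rewrite !mxE.
  have := yq i Logic.I; rewrite /= mxE -ball_normE /= => yqi.
  have xqi := svalP (Hq i).
  rewrite -(subrKA (ratr (sval (Hq i)))) (le_trans (ler_normD _ _))// lerD// ltW//.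
  by rewrite distrC.
apply: countable_bigcupT_measurable => [|p]; first exact: countableP.
by case: ifP.
Qed.

Lemma closed_measurable_rV (A : set 'rV[R]_n) : closed A -> measurable A.
Proof. by move/closed_openC/open_measurable_rV/measurableC; rewrite setCK. Qed.

Lemma continuous_measurable_rV (f : 'rV[R]_n -> R) :
  continuous f -> measurable_fun setT f.
Proof.
move=> /continuousP cf; apply: (measurability _ (RGenOpens.measurableE R)).
move=> _ [_ [a [b ->] <-]]; rewrite setTI; apply: open_measurable_rV.
exact/cf/interval_open.
Qed.

Lemma closed_norm_le (M : R) : closed [set x : 'rV[R]_n | `|x| <= M].
Proof.
have -> : [set x : 'rV[R]_n | `|x| <= M] = (fun x => `|x|) @^-1` [set r | r <= M].
  by [].
apply: closed_comp; last exact: closed_le.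
by move=> x _; exact: norm_continuous.
Qed.

Lemma measurable_norm_le (M : R) : measurable [set x : 'rV[R]_n | `|x| <= M].
Proof. by apply: closed_measurable_rV; exact: closed_norm_le. Qed.

Lemma addZ_coord (t : R) x y i : (t *: x + y) 0 i = t * x 0 i + y 0 i.
Proof. by rewrite mxE [X in X + _]mxE. Qed.

Lemma delta_coord j i : (delta_mx 0 j : 'rV[R]_n) 0 i = (i == j)%:R.
Proof. by rewrite mxE eqxx. Qed.

End row_vectors.

Section cons_rV.
Context {R : realType} {n : nat}.
Implicit Types (a : R) (y : 'rV[R]_n).

Lemma cons_rV_ord0 a y : cons_rV (a, y) 0 ord0 = a.
Proof.
rewrite (_ : ord0 = lshift n (0 : 'I_1)); last exact/val_inj.
by apply: etrans (row_mxEl _ _ _ _) _; rewrite mxE eqxx.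
Qed.

Lemma cons_rV_lift a y i : cons_rV (a, y) 0 (lift ord0 i) = y 0 i.
Proof.
rewrite (_ : lift ord0 i = rshift 1 i); last exact/val_inj.
exact: (row_mxEr (a%:M : 'rV_1) y 0 i).
Qed.

Lemma norm_cons_rV_le a y M : 0 <= M ->
  (`|cons_rV (a, y)| <= M) = (`|a| <= M) && (`|y| <= M).
Proof.
move=> M0; rewrite !norm_rV_le//; apply/forallP/andP => [H|[aM /forallP yM] i].
  split; first by have := H ord0; rewrite cons_rV_ord0.
  by apply/forallP => i; have := H (lift ord0 i); rewrite cons_rV_lift.
by have [j ->|->] := unliftP ord0 i; rewrite ?cons_rV_lift ?cons_rV_ord0.
Qed.

Lemma continuous_cons_rV a : continuous (fun y => cons_rV (a, y)).
Proof.
move=> y; apply: (@cvg_rV R n.+1 _ (nbhs y) (nbhs_filter y)) => i.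
have [j ->|->] := unliftP ord0 i.
  under eq_fun do rewrite cons_rV_lift; rewrite cons_rV_lift.
  exact: continuous_coord.
by under eq_fun do rewrite cons_rV_ord0; rewrite cons_rV_ord0; exact: cvg_cst.
Qed.

Lemma continuous_cons_rV0 y : continuous (fun t : R => cons_rV (t, y)).
Proof.
move=> t; apply: (@cvg_rV R n.+1 _ (nbhs t) (nbhs_filter t)) => i.
have [j ->|->] := unliftP ord0 i.
  by under eq_fun do rewrite cons_rV_lift; rewrite cons_rV_lift; exact: cvg_cst.
by under eq_fun do rewrite cons_rV_ord0; rewrite cons_rV_ord0; exact: cvg_id.
Qed.

Lemma cons_rV_line0 (t : R) y :
  cons_rV (t, y) = t *: delta_mx 0 ord0 + cons_rV (0, y).
Proof.
apply/rowP => i; rewrite addZ_coord delta_coord.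
have [j ->|->] := unliftP ord0 i.
  by rewrite !cons_rV_lift mulr0 add0r.
by rewrite !cons_rV_ord0 mulr1 addr0.
Qed.

Lemma cons_rV_line a (t : R) y j :
  cons_rV (a, t *: delta_mx 0 j + y) =
  t *: delta_mx 0 (lift ord0 j) + cons_rV (a, y).
Proof.
apply/rowP => i; rewrite addZ_coord delta_coord.
have [k ->|->] := unliftP ord0 i.
  by rewrite !cons_rV_lift addZ_coord delta_coord (inj_eq lift_inj).
by rewrite !cons_rV_ord0 mulr0 add0r.
Qed.

End cons_rV.

(** For the max norm, the preimage under cons_rV of a ball centred at 0 is a
    product of an interval and a ball. *)
Lemma lebesgue_norm_le_lty (R : realType) (n : nat) (M : R) :
  (lebesgue_rV R n [set x : 'rV[R]_n | (`|x| <= M)%R] < +oo)%E.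
Proof.
have [M0|M0] := leP 0 M; last first.
  rewrite (_ : [set x | _] = set0) ?measure0// -subset0 => x /= xM.
  by have := le_lt_trans xM M0; rewrite normr_lt0.
elim: n => [|n IH]; first by rewrite /= diracE ltry.
rewrite /= /lebesgue_cons /pushforward.
apply: (@le_lt_trans _ _ ((@lebesgue_measure R \x lebesgue_rV R n)%E
   (`[(- M)%R, M]%classic `*` [set y : 'rV[R]_n | (`|y| <= M)%R]))).
  apply: le_measure; rewrite ?inE.
  - rewrite -[X in measurable X]setTI; apply: measurable_cons_rV => //.
    exact: measurable_norm_le.
  - apply: measurableX; first exact: measurable_itv.
    exact: measurable_norm_le.
  - by move=> [a y] /=; rewrite norm_cons_rV_le// => /andP[]; rewrite in_itv ler_norml.
rewrite product_measure1E//; last exact: measurable_norm_le.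
have lM : (@lebesgue_measure R `[(- M)%R, M]%classic < +oo)%E.
  by rewrite lebesgue_measure_itv /=; case: ifP => // _; rewrite -EFinB ltry.
by apply: lte_mul_pinfty => //; rewrite ge0_fin_numE.
Qed.

Lemma integrable_rV (R : realType) (n : nat) (g : 'rV[R]_n -> R) (M : R) :
  continuous g -> (forall x, M < `|x| -> g x = 0) ->
  (lebesgue_rV R n).-integrable setT (EFin \o g).
Proof.
move=> cg g0; pose D := [set x : 'rV[R]_n | `|x| <= M].
have mD : measurable D by exact: measurable_norm_le.
have -> : EFin \o g = (EFin \o g) \_ D.
  apply/funext => x; rewrite patchE; case: ifPn => //.
  by rewrite notin_setE /D /= => /negP; rewrite -ltNge => /g0 ->.
apply: (integrable_mkcond (EFin \o g) mD).1.
apply: measurable_bounded_integrable => //.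
- exact: lebesgue_norm_le_lty.
- by apply: measurable_funTS; exact: continuous_measurable_rV.
- have cD : compact D.
    apply: bounded_closed_compact; last exact: closed_norm_le.
    exists M; split => [|N MN x /= xM]; first exact: num_real.
    by rewrite (le_trans xM)// ltW.
  have : compact (g @` D) by apply: continuous_compact => //; exact: continuous_subspaceT.
  move=> /compact_bounded[N [Nr HN]]; exists N; split => // L /HN gL x Dx.
  by apply: gL; exists x.
Qed.

Lemma integral_deriv_line (R : realType) (phi : R -> R) (M : R) :
  (forall t, derivable phi t 1) -> continuous (derive1 phi) ->
  (forall t, M < `|t| -> phi t = 0) ->
  (\int[lebesgue_measure]_t (derive1 phi t)%:E = 0)%E.
Proof.
move=> dphi cphi' phi0; pose L : R := `|M| + 1.
have ML : M < L by rewrite (le_lt_trans (ler_norm M))// ltrDl.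
have L0 : 0 < L by rewrite ltr_wpDl.
have phi'0 (t : R) : M < `|t| -> derive1 phi t = 0.
  by rewrite derive1E; exact: derive_vanishing_outside.
rewrite (_ : (fun t => _) =
    ((fun t => (derive1 phi t)%:E) \_ `[(- L)%R, L]%classic)%E); last first.
  apply/funext => t; rewrite patchE; case: ifPn => // /negP.
  rewrite inE /= in_itv /= -ler_norml => /negP; rewrite -ltNge => Lt.
  by rewrite phi'0// (lt_trans ML).
rewrite -integral_mkcond (@continuous_FTC2 _ _ phi).
- by rewrite !phi0 ?normrN ?gtr0_norm// subee.
- by rewrite gtrN.
- exact: continuous_subspaceT.
- have cphi : continuous phi.
    by move=> t; apply: differentiable_continuous; exact/derivable1_diffP.
  split => [t _| |]; first exact: dphi.
  + exact: cvg_at_right_filter (cphi _).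
  + exact: cvg_at_left_filter (cphi _).
- by [].
Qed.

(** Induction on the dimension. The outer integral vanishes because the inner
    one does: for the first coordinate Fubini puts the variable of
    differentiation inside and the fundamental theorem applies, for the others
    the slice at a fixed first coordinate is a function of one variable less. *)
Lemma integral_derive_rV (R : realType) (n : nat) (g : 'rV[R]_n -> R) (M : R) (j : 'I_n) :
  0 <= M ->
  (forall x, derivable g x (delta_mx 0 j)) -> continuous ('D_(delta_mx 0 j) g) ->
  (forall x, M < `|x| -> g x = 0) ->
  (\int[lebesgue_rV R n]_x ('D_(delta_mx 0 j) g x)%:E = 0)%E.
Proof.
move=> M0; elim: n g j => [|n IH] g j; first by case: j.
move=> dg cg g0; set G := 'D_(delta_mx 0 j) g.
have G0 x : M < `|x| -> G x = 0 by exact: derive_vanishing_outside.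
have mG : measurable_fun setT (EFin \o G).
  by apply/measurable_EFinP; exact: continuous_measurable_rV.
have iG : (lebesgue_rV R n.+1).-integrable setT (EFin \o G) by exact: integrable_rV cg G0.
pose H (p : measurableTypeR R * 'rV[R]_n) := (G (cons_rV p))%:E.
have mH : measurable_fun setT H.
  by apply: (measurableT_comp mG); exact: measurable_cons_rV.
have iH : (@lebesgue_measure R \x lebesgue_rV R n)%E.-integrable setT H.
  apply/integrableP; split => //; have /integrableP[_] := iG.
  rewrite [X in (X < _)%E -> _](_ : _ =
    \int[pushforward (@lebesgue_measure R \x lebesgue_rV R n)%E (@cons_rV R n)]_x
      (abse \o (EFin \o G)) x)%E//.
  rewrite ge0_integral_pushforward//.
  - exact: measurable_cons_rV.
  - exact: measurableT_comp.
  - by move=> y _; exact: abse_ge0.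
transitivity (\int[@lebesgue_measure R \x lebesgue_rV R n]_p H p)%E.
  exact: (integral_pushforward (@measurable_cons_rV R n) mG iH measurableT).
have [k jE|jE] := unliftP ord0 j.
- rewrite -integral12_prod_meas1//; apply: integral0_eq => a _.
  rewrite /fubini_F /H.
  have dE y : 'D_(delta_mx 0 k) (fun y => g (cons_rV (a, y))) y = G (cons_rV (a, y)).
    by apply: (eq_on_line _ _ _ _ _ _ _).1 => h; rewrite cons_rV_line -jE.
  under eq_integral do rewrite -dE.
  apply: IH.
  + move=> y; apply: (eq_on_line _ _ _ _ _ _ _).2 (dg (cons_rV (a, y))) => h.
    by rewrite cons_rV_line -jE.
  + rewrite (_ : 'D_ _ _ = G \o (fun y => cons_rV (a, y))); last exact/funext.
    move=> y; apply: continuous_comp; last exact: cg.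
    exact: continuous_cons_rV.
  + move=> y My; apply: g0; rewrite ltNge norm_cons_rV_le// negb_and -!ltNge My.
    by rewrite orbT.
- rewrite -integral21_prod_meas1//; apply: integral0_eq => y _.
  rewrite /fubini_G /H.
  have dphi t : is_derive t (1 : R) (fun t : R => g (cons_rV (t, y))) (G (cons_rV (t, y))).
    have E s : s *: delta_mx 0 j + cons_rV (0, y) = cons_rV (s, y).
      by rewrite [RHS]cons_rV_line0 jE.
    have := is_derive_line g (cons_rV (0, y)) (delta_mx 0 j) t (dg _).
    by under eq_fun do rewrite E; rewrite E.
  have dE : derive1 (fun t : R => g (cons_rV (t, y))) = (fun t => G (cons_rV (t, y))).
    by apply/funext => t; rewrite derive1E; exact: (@derive_val _ _ _ _ _ _ _ (dphi t)).
  transitivity (\int[lebesgue_measure]_t (derive1 (fun t : R => g (cons_rV (t, y))) t)%:E)%E.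
    by rewrite dE.
  apply: (integral_deriv_line _ _ M).
  + by move=> t; case: (dphi t).
  + rewrite dE => t.
    apply: (@continuous_comp _ _ _ (fun s : R => cons_rV (s, y)) G); last exact: cg.
    exact: continuous_cons_rV0.
  + move=> t Mt; apply: g0; rewrite ltNge norm_cons_rV_le// negb_and -!ltNge Mt.
    by [].
Qed.

(** * Horizontal vector fields *)

(** Restriction to the slice y = 0 of the product keeps the derivatives in the
    directions (v, 0). *)
Lemma Ck1_slice (R : realType) (n : nat) (f : 'rV[R]_n * 'rV[R]_n -> 'rV[R]_n) j :
  Ck 1 f -> Ck 1 (fun x => f (x, 0) 0 j).
Proof.
move=> [cf df Df].
have slice (g : 'rV[R]_n * 'rV[R]_n -> 'rV[R]_n) : continuous g ->
    continuous (fun x => g (x, 0) 0 j).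
  move=> cg x; apply: (@continuous_comp _ _ _ (fun x => g (x, 0)) (fun y => y 0 j)).
    apply: (@continuous_comp 'rV[R]_n ('rV[R]_n * 'rV[R]_n)%type 'rV[R]_n
      (fun x => (x, 0)) g); last exact: cg.
    exact: (@cvg_pair _ _ _ (nbhs x) (nbhs x) (nbhs (0 : 'rV[R]_n)) _ _ _ id (fun=> 0)
      cvg_id (cvg_cst _)).
  exact: continuous_coord.
have D v x : 'D_v (fun x => f (x, 0)) x = 'D_(v, 0) f (x, 0) /\
    (derivable f (x, 0) (v, 0) -> derivable (fun x => f (x, 0)) x v).
  have E h : f (h *: (v, 0) + (x, 0)) = f (h *: v + x, 0).
    by congr f; rewrite /GRing.add /= /add_pair /= scaler0 addr0.
  have [] := eq_on_line f (fun x => f (x, 0)) (x, 0) (v, 0) x v E.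
  by move=> <-.
have dD v x := (D v x).2 (df (v, 0) (x, 0)).
split => [|v x|v].
- exact: slice.
- exact: ((derivable_mxP _ _ _).1 (dD v x) 0 j).
- rewrite (_ : 'D_v _ = fun x => 'D_(v, 0) f (x, 0) 0 j).
    exact: (slice ('D_(v, 0) f) (Df (v, 0))).
  by apply/funext => x; rewrite -(D v x).1 (derive_mx (dD v x)) mxE.
Qed.

Section group.
Context {R : realType}.
Variable G : stratifiedGroup R.
Local Notation n := (sg_dim G).
Local Notation V := 'rV[R]_n.
Local Notation mul := (@sg_op R G : V -> V -> V).
Local Notation e_ k := (delta_mx 0 k : V).
Implicit Types (k j : 'I_n) (x y : V) (f g w : V -> R).

(** The coefficient of d/dx_j in the vector field X_k. *)
Definition coefX k j x : R := leftX k x 0 j.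

(** The exponent with which the dilations act on the j-th coordinate. *)
Definition weight j : nat := (reshape_index (strata G) j).+1.

Let mulp (p : V * V) : V := mul p.1 p.2.

(** X_k is a partial derivative of the group law on the product space, which
    transfers its smoothness to X_k. *)
Lemma derive_op k x : leftX k x = 'D_(0, e_ k) mulp (x, 0) /\
  derivable (mul x) 0 (e_ k).
Proof.
have E h : mulp (h *: (0, e_ k) + (x, 0)) = mul x (h *: e_ k + 0).
  by rewrite /mulp /= scaler0 add0r.
have [H1 H2] := eq_on_line mulp (mul x) (x, 0) (0, e_ k) 0 (e_ k) E.
split; first exact/esym.
by apply: H2; have [_ d _] := sg_op_smooth G 1; exact: d.
Qed.

Lemma Ck1_coefX k j : Ck 1 (coefX k j).
Proof.
rewrite (_ : coefX k j = fun x => 'D_(0, e_ k) mulp (x, 0) 0 j).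
  by apply: (Ck1_slice _ _ ('D_(0, e_ k) mulp)); have [_ _ d] := sg_op_smooth G 2; exact: d.
by apply/funext => x; rewrite /coefX (derive_op k x).1.
Qed.

Lemma coefXE k j x : coefX k j x = 'D_(e_ k) (fun y => mul x y 0 j) 0.
Proof.
rewrite /coefX /leftX /left_invariant_field.
by rewrite (derive_mx (derive_op k x).2) mxE.
Qed.

Lemma weight_horizontal k : horizontal k -> weight k = 1%N.
Proof.
rewrite /weight /horizontal /reshape_index; move: k; rewrite /sg_dim.
case: (strata G) => [|d N] //= k kd.
by rewrite -subn_eq0 in kd; rewrite (eqP kd).
Qed.

Lemma dilationE (l : R) x j : dilation l x 0 j = l ^+ weight j * x 0 j.
Proof. by rewrite mxE. Qed.

Lemma dilation_line (l t : R) j x :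
  dilation l (t *: e_ j + x) = t *: (l ^+ weight j *: e_ j) + dilation l x.
Proof.
apply/rowP => i; rewrite dilationE !addZ_coord dilationE [(_ *: e_ j) 0 i]mxE delta_coord.
by case: eqP => [->|_]; rewrite ?(mulr0, mulr1) mulrDr ?mulr0 // mulrC.
Qed.

(** Differentiate at y = 0 the identity (delta_l x) (delta_l y) = delta_l (x y)
    in the horizontal direction e_k, on which delta_l acts as l. *)
Lemma coefX_homogeneous k j (l : R) x : 0 < l -> horizontal k ->
  l * coefX k j (dilation l x) = l ^+ weight j * coefX k j x.
Proof.
move=> l0 hk; rewrite !coefXE.
have dop z : derivable (fun y => mul z y 0 j) 0 (e_ k).
  exact: ((derivable_mxP _ _ _).1 (derive_op k z).2 0 j).
rewrite -(deriveZr _ _ _ _ (dop _)) -(deriveMl _ (dop x)).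
have E h : mul (dilation l x) (h *: (l *: e_ k) + 0) 0 j =
    ((l ^+ weight j) \*o (fun y => mul x y 0 j)) (h *: e_ k + 0).
  have -> : h *: (l *: e_ k) + 0 = dilation l (h *: e_ k + 0).
    rewrite dilation_line (weight_horizontal _ hk) expr1; congr (_ + _).
    by apply/rowP => i; rewrite dilationE !mxE mulr0.
  by rewrite -(@sg_dilation R G l l0) dilationE.
exact: (eq_on_line _ _ _ _ _ _ E).1.
Qed.

(** By homogeneity b' = 'D_(e_ j) (coefX k j) satisfies
    b' x = l * b' (dilation l x) for all l > 0, and the right-hand side tends to
    0 * b' 0 as l tends to 0. *)
Lemma derive_coefX_eq0 k j x : horizontal k -> 'D_(e_ j) (coefX k j) x = 0.
Proof.
move=> hk; have [_ db Db] := Ck1_coefX k j.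
set b := coefX k j in db Db *; set b' := 'D_(e_ j) b.
have scal (l : R) : 0 < l -> l * b' (dilation l x) = b' x.
  move=> l0; pose c := l ^+ weight j.
  have c0 : c != 0 by rewrite expf_neq0// gt_eqF.
  apply: (mulfI c0); rewrite mulrCA.
  have E1 := deriveZr b (dilation l x) (e_ j) c (db _ _).
  have E2 := deriveMl l (db (c *: e_ j) (dilation l x)).
  have E3 := deriveMl c (db (e_ j) x).
  have D h : (l \*o b) (h *: (c *: e_ j) + dilation l x) = (c \*o b) (h *: e_ j + x).
    by rewrite -dilation_line; exact: coefX_homogeneous.
  have [E4 _] := eq_on_line _ _ _ _ _ _ D.
  exact: (etrans (congr1 (fun z => l * z) (esym E1)) (etrans (esym E2) (etrans E4 E3))).
have lim0 : (fun l : R => l * b' (dilation l x)) @ (0 : R)^'+ --> 0 * b' (dilation 0 x).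
  apply: cvg_at_right_filter; apply: cvgM; first exact: cvg_id.
  apply: (@continuous_comp _ _ _ (fun l : R => dilation l x) b'); last exact: Db.
  apply: (@cvg_rV R n _ (nbhs (0 : R)) _) => i.
  under eq_fun do rewrite dilationE; rewrite dilationE.
  apply: cvgM; last exact: cvg_cst.
  exact: exprn_continuous.
have limc : (fun l : R => l * b' (dilation l x)) @ (0 : R)^'+ --> b' x.
  apply: cvg_near_cst; near=> l; apply: scal; near: l; exact: nbhs_right_gt.
by have := cvg_unique _ limc lim0; rewrite mul0r; apply.
Unshelve. all: by end_near. Qed.

Lemma XderE k f x : Ck 1 f ->
  Xder k f x = \sum_(j < n) coefX k j x * 'D_(e_ j) f x.
Proof. exact: derive_rV. Qed.

Lemma continuous_Xder k f : Ck 1 f -> continuous (Xder k f).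
Proof.
move=> C1f; have [_ _ Df] := C1f.
rewrite (_ : Xder k f = fun x => \sum_(j < n) coefX k j x * 'D_(e_ j) f x); last first.
  by apply/funext => x; exact: XderE.
apply: continuous_bigsum => j _ x; have [ca _ _] := Ck1_coefX k j.
exact: (continuousM (ca x) (Df (e_ j) x)).
Qed.

Lemma Ck1_Xder k f : Ck 2 f -> Ck 1 (Xder k f).
Proof.
move=> C2f; have C1f := Ck2_Ck1 f C2f; have [_ _ Df] := C2f.
rewrite (_ : Xder k f = fun x => \sum_(j < n) coefX k j x * 'D_(e_ j) f x); last first.
  by apply/funext => x; exact: XderE.
apply: (Ck1_sum _ _ _ _ _).1 => j _; apply: Ck1_mul; last exact: Df.
exact: Ck1_coefX.
Qed.

Lemma Xder_mul k f g x : Ck 1 f -> Ck 1 g ->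
  Xder k (fun y => f y * g y) x = Xder k f x * g x + f x * Xder k g x.
Proof. by move=> [_ df _] [_ dg _]; exact: derive_mul. Qed.

(** X_k has no divergence, so X_k w is the Euclidean divergence of w X_k. *)
Lemma integral_Xder k w (M : R) : horizontal k -> 0 <= M -> Ck 1 w ->
  (forall x, M < `|x| -> w x = 0) -> (\int[haar G]_x (Xder k w x)%:E = 0)%E.
Proof.
move=> hk M0 C1w w0.
pose W j x := coefX k j x * w x.
have C1W j : Ck 1 (W j) := Ck1_mul _ _ (Ck1_coefX k j) C1w.
have W0 j x : M < `|x| -> W j x = 0 by move=> /w0; rewrite /W => ->; rewrite mulr0.
under eq_integral => x _.
  rewrite XderE// (eq_bigr (fun j => 'D_(e_ j) (W j) x)).
    rewrite -sumEFin; over.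
  move=> j _; have [_ dc _] := Ck1_coefX k j; have [_ dw _] := C1w.
  by rewrite derive_mul// derive_coefX_eq0// mul0r add0r.
rewrite integral_sum//.
  apply: big1 => j _; have [_ dW DW] := C1W j.
  exact: (integral_derive_rV _ _ (W j) M j M0 (dW _) (DW _) (W0 j)).
move=> j; have [_ _ DW] := C1W j.
apply: (integrable_rV _ _ _ M); first exact: DW.
by move=> x; apply: derive_vanishing_outside => y; exact: W0.
Qed.

End group.

(** * The remainder formula *)

Section remainder.
Context {R : realType}.
Variable G : stratifiedGroup R.
Local Notation n := (sg_dim G).
Local Notation V := 'rV[R]_n.

Lemma sqr_L2norm (f : V -> R) :
  (L2norm f ^+ 2 = \int[haar G]_x (f x ^+ 2)%:E)%E.
Proof.
have poweR2 (x : \bar R) : (0 <= x)%E -> (x ^+ 2 = x `^ 2)%E.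
  case: x => [r| |]; rewrite ?lee_fin// => r0; first by rewrite poweR_EFin powR_mulrn.
  by rewrite poweRE pnatr_eq0 eqxx.
rewrite poweR2 ?Lnorm_ge0// poweR_Lnorm ?pnatr_eq0//.
by apply: eq_integral => x _; rewrite -poweR2// -EFin_expe real_normK ?num_real.
Qed.

Definition sqgradH (f : V -> R) x : R := \sum_(k < n | horizontal k) Xder k f x ^+ 2.

Lemma sqr_L2normv_gradH (c f : V -> R) :
  (L2normv (fun x => c x *: gradH f x) ^+ 2 =
   \int[haar G]_x (c x ^+ 2 * sqgradH f x)%:E)%E.
Proof.
rewrite sqr_L2norm; apply: eq_integral => x _; congr EFin.
rewrite enorm_sqr /dotp /sqgradH mulr_sumr [RHS]big_mkcond.
by apply: eq_bigr => k _; rewrite !mxE; case: ifP => _; ring.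
Qed.

Section identity.
Variables rho F f : V -> R.
Hypothesis C1rho : Ck 1 rho.
Hypotheses (F0 : forall x, 0 <= F x) (C2F : Ck 2 F) (C1f : Ck 1 f).
Hypothesis cf : compact (supp f).
Hypothesis Fpos : forall x, supp f x -> 0 < F x.

Let h x := f x / F x.

(** The density whose integral separates remainder and energy: it dominates
    eta f^2 wherever eta F <= - L2rho rho F. *)
Let q x := h x ^+ 2 * F x * - L2rho rho F x.

Let C1F : Ck 1 F. Proof. exact: Ck2_Ck1. Qed.

Let C1h : Ck 1 h.
Proof. by apply: Ck1_div_supp => // x /Fpos; exact: lt0r_neq0. Qed.

(** Where F vanishes f does as well, so the convention f / 0 = 0 is harmless. *)
Let fE : f = fun x => h x * F x.
Proof.
apply/funext => x; rewrite /h; have [Fx|Fx] := eqVneq (F x) 0; last by rewrite divfK.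
rewrite Fx mulr0; apply/eqP; apply: contraPT Fx => fx.
by apply/eqP; rewrite gt_eqF// Fpos//; exact: subset_closure.
Qed.

Let supported : exists2 M : R, 0 <= M & forall x, M < `|x| -> f x = 0.
Proof.
have /compact_bounded[M [Mr HM]] := cf.
exists (`|M| + 1) => [|x Mx]; first by rewrite addr_ge0.
apply/eqP; apply: contraTT Mx => fx; rewrite -leNgt.
apply: HM; first by rewrite (le_lt_trans (ler_norm M))// ltrDl.
exact: subset_closure.
Qed.

(** The components of rho grad_H F. *)
Let flux k x := rho x * Xder k F x.

Let C1flux k : Ck 1 (flux k).
Proof. exact: (Ck1_mul _ _ C1rho (Ck1_Xder _ k F C2F)). Qed.

Lemma L2rhoE x : L2rho rho F x = \sum_(k < n | horizontal k) Xder k (flux k) x.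
Proof.
apply: eq_bigr => k hk; congr (Xder k _ x).
by apply/funext => y; rewrite !mxE hk.
Qed.

Let continuous_L2rho : continuous (L2rho rho F).
Proof.
rewrite (_ : L2rho rho F = fun x => \sum_(k < n | horizontal k) Xder k (flux k) x).
  by apply: continuous_bigsum => k _; exact: (continuous_Xder _ k (flux k) (C1flux k)).
by apply/funext => x; exact: L2rhoE.
Qed.

(** Substitute f = h F and use the product rule: the terms of
    |grad_H (h F)|^2 other than F^2 |grad_H h|^2 add up to
    grad_H (h^2 F) . grad_H F, and rho times this is q plus a divergence. *)
Lemma pointwise_identity x :
  rho x * F x ^+ 2 * sqgradH h x = rho x * sqgradH f x - q x
    - \sum_(k < n | horizontal k) Xder k (fun y => h y ^+ 2 * F y * flux k y) x.
Proof.
have C1h2 : Ck 1 (fun y => h y ^+ 2) := Ck1_mul h h C1h C1h.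
have C1h2F : Ck 1 (fun y => h y ^+ 2 * F y) := Ck1_mul _ _ C1h2 C1F.
rewrite /q L2rhoE /sqgradH mulrN opprK mulr_sumr.
rewrite [rho x * bigop _ _ _]mulr_sumr [h x ^+ 2 * F x * bigop _ _ _]mulr_sumr.
rewrite -sumrN -!big_split /=.
apply: eq_bigr => k hk.
rewrite (Xder_mul _ _ _ _ _ C1h2F (C1flux k)) (Xder_mul _ _ _ _ _ C1h2 C1F).
rewrite (Xder_mul _ _ h h) // [in Xder k f x]fE (Xder_mul _ _ h F)// /flux.
ring.
Qed.

Lemma integrable_q : (haar G).-integrable setT (EFin \o q).
Proof.
have [M M0 f0] := supported; have [ch _ _] := C1h; have [cF _ _] := C1F.
apply: (integrable_rV _ _ _ M) => [x|x /f0 fx].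
  exact: (continuousM (continuousM (continuousM (ch x) (ch x)) (cF x))
    (continuousN (continuous_L2rho x))).
by rewrite /q /h fx mul0r expr0n mul0r mul0r.
Qed.

Lemma integrable_energy :
  (haar G).-integrable setT (fun x => (rho x * sqgradH f x)%:E).
Proof.
have [M M0 f0] := supported; have [cr _ _] := C1rho.
apply: (integrable_rV _ _ _ M) => [x|x Mx].
  apply: (continuousM (cr x)); apply: continuous_bigsum => k _ {}x.
  have cX := continuous_Xder _ k f C1f; exact: (continuousM (cX x) (cX x)).
rewrite /sqgradH big1 ?mulr0// => k _.
by rewrite /Xder (derive_vanishing_outside _ _ _ M)// expr0n.
Qed.

Lemma integral_remainder :
  (\int[haar G]_x (rho x * F x ^+ 2 * sqgradH h x)%:E =
   \int[haar G]_x (rho x * sqgradH f x)%:E - \int[haar G]_x (q x)%:E)%E.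
Proof.
have [M M0 f0] := supported.
pose w k y := h y ^+ 2 * F y * flux k y.
have C1w k : Ck 1 (w k) :=
  Ck1_mul _ _ (Ck1_mul _ _ (Ck1_mul h h C1h C1h) C1F) (C1flux k).
have w0 k x : M < `|x| -> w k x = 0.
  by move=> /f0 fx; rewrite /w /h fx mul0r expr0n !mul0r.
have iw k : (haar G).-integrable setT (fun x => (Xder k (w k) x)%:E).
  apply: (integrable_rV _ _ _ M); first exact: (continuous_Xder _ k (w k) (C1w k)).
  by move=> x; exact: derive_vanishing_outside (w0 k).
have divw : (\int[haar G]_x (\sum_(k < n | horizontal k) (Xder k (w k) x)%:E) = 0)%E.
  rewrite integral_sum//; apply: big1 => k hk.
  exact: (integral_Xder G k (w k) M hk M0 (C1w k) (w0 k)).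
under eq_integral => x _ do rewrite pointwise_identity EFinB EFinB -sumEFin.
rewrite integralB//; first last.
- exact: integrable_sum.
- by apply: integrableB => //; [exact: integrable_energy|exact: integrable_q].
rewrite divw sube0 integralB//; [exact: integrable_energy|exact: integrable_q].
Qed.

Section potential.
Variable eta : V -> R.
Hypothesis meta : measurable_fun setT eta.
Hypothesis eta0 : {ae haar G, forall x, 0 <= eta x}.

(** Num.sqrt vanishes on negative numbers, so p is eta f^2 only where eta >= 0. *)
Let p x := (Num.sqrt (eta x) * f x) ^+ 2.

Let mp : measurable_fun setT p.
Proof.
have [cf' _ _] := C1f.
apply: measurable_funX; apply: measurable_funM; last exact: continuous_measurable_rV.
by apply: measurableT_comp => //; apply: continuous_measurable_fun; exact: sqrt_continuous.
Qed.

Let pE x : 0 <= eta x -> p x = h x ^+ 2 * F x * (eta x * F x).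
Proof. by move=> ex; rewrite /p exprMn sqr_sqrtr// fE; ring. Qed.

(** The bound p <= q and the sign of q hold only almost everywhere; passing
    through the positive part of q turns the comparison into one of nonnegative
    functions. *)
Lemma potential_le : {ae haar G, forall x, eta x * F x <= - L2rho rho F x} ->
  (\int[haar G]_x (p x)%:E <= \int[haar G]_x (q x)%:E)%E.
Proof.
move=> sup; have iq := integrable_q.
have pq : {ae haar G, forall x, p x <= q x}.
  apply: filterS2 eta0 sup => x ex sx.
  by rewrite pE// /q ler_wpM2l// mulr_ge0// sqr_ge0.
have p0 x : 0 <= p x by exact: sqr_ge0.
have mq : measurable_fun setT q by apply/measurable_EFinP; exact: measurable_int iq.
apply: (@le_trans _ _ (\int[haar G]_x (Num.max (q x) 0)%:E)%E).
  apply: ae_ge0_le_integral => //.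
  - by move=> x _; rewrite lee_fin.
  - exact/measurable_EFinP.
  - by move=> x _; rewrite lee_fin le_max lexx orbT.
  - by apply/measurable_EFinP; apply: measurable_maxr.
  - by apply: filterS pq => x pqx _; rewrite lee_fin le_max pqx.
rewrite le_eqVlt; apply/orP; left; apply/eqP; apply: ae_eq_integral => //.
- by apply/measurable_EFinP; apply: measurable_maxr.
- exact/measurable_EFinP.
- by apply: filterS pq => x pqx _; rewrite max_l// (le_trans _ pqx).
Qed.

Lemma potential_eq : {ae haar G, forall x, eta x * F x = - L2rho rho F x} ->
  (\int[haar G]_x (p x)%:E = \int[haar G]_x (q x)%:E)%E.
Proof.
move=> sup; apply: ae_eq_integral => //.
- exact/measurable_EFinP.
- exact: measurable_int integrable_q.
- by apply: filterS2 eta0 sup => x ex sx _; rewrite pE// /q sx.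
Qed.

End potential.
End identity.
End remainder.

Theorem mainTheorem13 (R : realType) :
  (forall (n : nat) (x y : 'rV[R]_n), expansion 2 1 x y = enorm (x + y) `^ 2)
  /\
  (forall (G : stratifiedGroup R) (rho F eta : 'rV[R]_(sg_dim G) -> R),
    (forall x, 0 <= rho x) -> Ck 1 rho ->
    (forall x, 0 <= F x) -> smooth F ->
    {ae haar G, forall x, 0 <= eta x} -> L1loc eta ->
    {ae haar G, forall x, eta x * F x <= - L2rho rho F x} ->
    forall f : 'rV[R]_(sg_dim G) -> R,
      test_function f ->
      (forall x, supp f x -> 0 < F x) ->
      let remainder := L2normv (fun x =>
        (Num.sqrt (rho x) * F x) *: gradH (fun y => f y / F y) x) in
      let energy := L2normv (fun x => Num.sqrt (rho x) *: gradH f x) in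
      let potential := L2norm (fun x => Num.sqrt (eta x) * f x) in
      (remainder ^+ 2 <= energy ^+ 2 - potential ^+ 2)%E
      /\ ({ae haar G, forall x, eta x * F x = - L2rho rho F x} ->
          (remainder ^+ 2 = energy ^+ 2 - potential ^+ 2)%E)).
Proof.
split => [n x y|G rho F eta rho0 C1rho F0 sF eta0 [meta _] sup f [sf cf] Fpos].
  exact: expansion2.
move=> remainder energy potential; have C2F := sF 2; have C1f := sf 1.
have energyE : (energy ^+ 2 = \int[haar G]_x (rho x * sqgradH G f x)%:E)%E.
  apply: etrans (sqr_L2normv_gradH G (fun x => Num.sqrt (rho x)) f) _.
  by apply: eq_integral => x _; rewrite sqr_sqrtr.
have remainderE : (remainder ^+ 2 = \int[haar G]_x (rho x * sqgradH G f x)%:E -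
    \int[haar G]_x ((f x / F x) ^+ 2 * F x * - L2rho rho F x)%:E)%E.
  apply: etrans (integral_remainder G rho F f C1rho C2F C1f cf Fpos).
  apply: etrans (sqr_L2normv_gradH G (fun x => Num.sqrt (rho x) * F x) _) _.
  by apply: eq_integral => x _; rewrite exprMn sqr_sqrtr.
have eq_lee (a b : \bar R) : a = b -> (a <= b)%E by move=> ->.
have potentialE := sqr_L2norm G (fun x => Num.sqrt (eta x) * f x).
split => [|eqL].
  apply: le_trans (eq_lee _ _ remainderE) _.
  apply: leeB; first exact: eq_lee _ _ (esym energyE).
  by apply: le_trans (eq_lee _ _ potentialE) _; exact: potential_le.
apply: etrans remainderE _; congr (_ - _)%E; first exact: esym.
by apply: esym; apply: etrans potentialE _; exact: potential_eq.
Qed.
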